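(* Let $K\subseteq\mathbb{R}^n$ be a nonempty closed set, $N\in\mathbb{N}$, and let $f_1,\ldots,f_N:K\to\overline{\mathbb{R}}$ be proper lower semicontinuous functions. Put $f:=\sum_{i=1}^N f_i$. Let $x_0\in\mathbb{R}^n$, let $(\beta_k)_{k\in\mathbb{N}_0}$ be a sequence of positive real numbers satisfying $$\sum_{k=0}^{\infty}\beta_k=+\infty,\qquad \sum_{k=0}^{\infty}\beta_k^2<+\infty,$$ for each $k\in\mathbb{N}_0$ let $\pi_k:\{1,\ldots,N\}\to\{1,\ldots,N\}$ be a permutation, and let $(x_l)_{l\in\mathbb{N}_0}$ be defined recursively by $$x_{kN+j}\in\mathrm{Prox}_{\beta_k f_{\pi_k(j)}}(K,x_{kN+(j-1)}),\qquad j=1,\ldots,N,\ k\in\mathbb{N}_0.$$ If $\operatorname{argmin}_K f\neq\emptyset$ and the functions $f_1,\ldots,f_N$ are Lipschitz continuous with a common constant $L$ and prox-convex on $K$ with modulus $\alpha>0$, then the sequence $(x_l)$ converges to a minimizer of $f$ (on $K$).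
   Context: $\mathbb{R}^n$ carries the Euclidean inner product $\langle\cdot,\cdot\rangle$ and norm $\|\cdot\|$; $\overline{\mathbb{R}}=\mathbb{R}\cup\{\pm\infty\}$; $\mathbb{N}_0=\{0,1,2,\ldots\}$. A function $h:K\to\overline{\mathbb{R}}$ is proper if it never takes the value $-\infty$ and $\mathrm{dom}\,h:=\{x\in K: h(x)<+\infty\}$ is nonempty. $\operatorname{argmin}_K f$ is the set of all minimal points of $f$ in $K$. For $\beta>0$ and $z\in\mathbb{R}^n$, $$\mathrm{Prox}_{\beta h}(K,z):=\operatorname{argmin}_{y\in K}\left\{h(y)+\frac{1}{2\beta}\|y-z\|^2\right\}.$$ Prox-convexity: let $K$ be closed, $h$ proper with $K\cap\mathrm{dom}\,h\neq\emptyset$, and $\beta>0$. Then $h$ is prox-convex on $K$ if there exists $\alpha>0$ such that for every $z\in K$, $\mathrm{Prox}_{\beta h}(K,z)\neq\emptyset$, and $$\bar x\in\mathrm{Prox}_{\beta h}(K,z)\ \Longrightarrow\ h(\bar x)-h(x)\le\frac{\alpha}{\beta}\langle\bar x-z,x-\bar x\rangle\quad\text{for all }x\in K.$$ The scalar $\alpha$ is called the prox-convex value, or modulus, of $h$ on $K$. *)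

(* Defs.v *)
From mathcomp Require Import all_boot all_order all_algebra all_fingroup.
From mathcomp Require Import all_classical all_reals all_analysis.

Set Implicit Arguments.
Unset Strict Implicit.
Unset Printing Implicit Defensive.

Import Order.TTheory GRing.Theory Num.Theory.
Import numFieldNormedType.Exports.

Local Open Scope classical_set_scope.
Local Open Scope ring_scope.

(* The library norm on row vectors is the sup norm, hence the explicit
   Euclidean structure below. The topology of 'rV[R]_n is the usual one. *)
Definition inner (R : realType) (n : nat) (u v : 'rV[R]_n) : R :=
  \sum_(i < n) u 0 i * v 0 i.

Definition enorm (R : realType) (n : nat) (u : 'rV[R]_n) : R :=
  Num.sqrt (inner u u).

(* A function K -> \bar R is represented by a function on the whole space of
   which only the values on K are ever used. *)
Definition proper_on (R : realType) (T : Type) (K : set T) (h : T -> \bar R) :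
  Prop :=
  (forall x, K x -> h x != -oo%E) /\ (exists2 x, K x & (h x < +oo)%E).

(* Lower semicontinuity for the topology induced on K. *)
Definition lsc_on (R : realType) (n : nat) (K : set 'rV[R]_n)
    (h : 'rV[R]_n -> \bar R) : Prop :=
  lower_semicontinuous (h : subspace K -> \bar R).

(* As +oo - +oo = -oo in \bar R, a function satisfying this is finite on K. *)
Definition elipschitz_on (R : realType) (n : nat) (K : set 'rV[R]_n) (L : R)
    (h : 'rV[R]_n -> \bar R) : Prop :=
  forall x y, K x -> K y -> (`|h x - h y| <= (L * enorm (x - y))%:E)%E.

Definition argmin_on (R : realType) (T : Type) (K : set T) (h : T -> \bar R) :
  set T :=
  [set x | K x /\ forall y, K y -> (h x <= h y)%E].

Definition Prox (R : realType) (n : nat) (beta : R) (h : 'rV[R]_n -> \bar R)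
    (K : set 'rV[R]_n) (z : 'rV[R]_n) : set 'rV[R]_n :=
  argmin_on K (fun y => h y + ((2 * beta)^-1 * enorm (y - z) ^+ 2)%:E)%E.

(* Prox-convexity of h on K for the proximal parameter beta, with modulus
   alpha. The conditions that K is closed, h is proper and alpha, beta are
   positive are left to the user. *)
Definition prox_convex_with (R : realType) (n : nat) (beta alpha : R)
    (K : set 'rV[R]_n) (h : 'rV[R]_n -> \bar R) : Prop :=
  forall z, K z ->
    Prox beta h K z !=set0 /\
    (forall xbar, Prox beta h K z xbar ->
     forall x, K x ->
       (h xbar - h x <= (alpha / beta * inner (xbar - z) (x - xbar))%:E)%E).

(* Main.v *)
Require Import Defs.
From mathcomp Require Import all_boot all_order all_algebra all_fingroup.
From mathcomp Require Import all_classical all_reals all_analysis.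
From mathcomp Require Import ring lra.

(** The prox-convexity inequality and the polarization identity bound the
    squared distance to any [y] in [K] after one proximal step; taking [y] to be
    the previous point shows that a step has length at most [beta_k L / alpha].
    Summed over a cycle, this gives for [z_k = x_(kN)] the quasi-Fejer inequality
      |z_(k+1) - y|^2 + (2 beta_k / alpha) (f z_k - f y) <=
      |z_k - y|^2 + C beta_k^2.
    With [y] a minimizer, [z] is bounded, and since the [beta_k] are not
    summable [f z_k] is frequently close to the minimum; hence [z] has a cluster
    point that is a minimizer. The inequality at that cluster point, with
    square-summable [beta_k], forces [z] to converge to it, and the vanishing
    steps carry the other [x_l] along. *)

Set Implicit Arguments.
Unset Strict Implicit.
Unset Printing Implicit Defensive.

Import Order.TTheory GRing.Theory Num.Theory.
Import numFieldNormedType.Exports.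

Local Open Scope classical_set_scope.
Local Open Scope ring_scope.

(** * Blocks and tails of nonnegative series *)

(** If every block starting at [m] stayed below [B], the partial sums would be bounded and the
    series finite. *)
Lemma nonneg_series_pinfty_gt (R : realType) (u : nat -> R) :
  (forall k, 0 <= u k) -> (\sum_(0 <= k <oo) (u k)%:E = +oo)%E ->
  forall (m : nat) (B : R), exists2 M, (m <= M)%N & B < \sum_(m <= k < M) u k.
Proof.
move=> u0 udvg m B; apply: contrapT => noM.
have bounded M : (\sum_(0 <= k < M) (u k)%:E <=
    (\sum_(0 <= k < m) u k + Num.max B 0)%:E)%E.
  rewrite sumEFin lee_fin; have [mM|Mm] := leqP m M.
    rewrite (@big_cat_nat _ _ _ m 0 M) //= lerD2l le_max; apply/orP; left.
    by rewrite leNgt; apply/negP => BM; apply: noM; exists M.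
  rewrite (@big_cat_nat _ _ _ M 0 m) ?(ltnW Mm) //= -addrA lerDl.
  rewrite addr_ge0 ?sumr_ge0 //.
  by rewrite le_max lexx orbT.
suff: (\sum_(0 <= k <oo) (u k)%:E <=
    (\sum_(0 <= k < m) u k + Num.max B 0)%:E)%E by rewrite udvg.
apply: lime_le; last exact: nearW.
by apply: is_cvg_nneseries => k _ _; rewrite lee_fin.
Qed.

(** A block is dominated by the infinite tail starting at the same index, and the tails of a
    convergent series vanish. *)
Lemma nonneg_series_tail_lt (R : realType) (u : nat -> R) :
  (forall k, 0 <= u k) -> (\sum_(0 <= k <oo) (u k)%:E < +oo)%E ->
  forall e : R, 0 < e -> exists m, forall p q, (m <= p)%N ->
    \sum_(p <= k < q) u k < e.
Proof.
move=> u0 ucvg e e0.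
have /fine_cvgP[_] := @nneseries_tail_cvg R (fun k => (u k)%:E) xpredT ucvg
  (fun k _ => u0 k).
move=> /cvgrPdist_lt /(_ e e0) [m _ tail]; exists m => p q mp.
have /= := tail p mp; rewrite sub0r normrN.
apply: le_lt_trans; apply: le_trans (ler_norm _).
have le_tail := @nneseries_lim_ge R (fun k => (u k)%:E) xpredT p q
  (fun k _ _ => u0 k).
rewrite -lee_fin fineK -?sumEFin //.
rewrite ge0_fin_numE; last first.
  by apply: le_trans le_tail; rewrite sumEFin lee_fin sumr_ge0.
apply: le_lt_trans ucvg.
rewrite [leRHS](@nneseries_split _ _ 0 p); last by move=> k _; rewrite lee_fin.
by rewrite add0n leeDr // sumEFin lee_fin sumr_ge0.
Qed.

(** The differences of [a] telescope; [m] lets the one-step inequality fail at first. *)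
Lemma quasi_fejer_sum (R : realType) (a d q : nat -> R) (m : nat) :
  (forall k, (m <= k)%N -> a k.+1 + d k <= a k + q k) ->
  forall p M, (m <= p)%N -> (p <= M)%N ->
  a M + \sum_(p <= k < M) d k <= a p + \sum_(p <= k < M) q k.
Proof.
move=> step p M mp; elim: M => [|M IH] pM.
  by move: pM; rewrite leqn0 => /eqP->; rewrite !big_geq.
move: pM; rewrite leq_eqVlt => /orP[/eqP->|pM]; first by rewrite !big_geq.
rewrite !big_nat_recr //=.
have := step M (leq_trans mp pM); have := IH pM; lra.
Qed.

(** * The Euclidean norm and its comparison with the sup-norm topology *)

Lemma inner_ge0 (R : realType) (n : nat) (u : 'rV[R]_n) : 0 <= inner u u.
Proof. by apply: sumr_ge0 => i _; rewrite -expr2 sqr_ge0. Qed.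

Lemma sqr_enorm (R : realType) (n : nat) (u : 'rV[R]_n) :
  enorm u ^+ 2 = inner u u.
Proof. by rewrite sqr_sqrtr // inner_ge0. Qed.

Lemma enorm_ge0 (R : realType) (n : nat) (u : 'rV[R]_n) : 0 <= enorm u.
Proof. exact: sqrtr_ge0. Qed.

Lemma sqr_coord_le (R : realType) (n : nat) (u : 'rV[R]_n) (i : 'I_n) :
  u 0 i ^+ 2 <= inner u u.
Proof.
rewrite /inner (bigD1 i) //= -expr2 lerDl.
by apply: sumr_ge0 => j _; rewrite -expr2 sqr_ge0.
Qed.

Lemma coord_le_enorm (R : realType) (n : nat) (u : 'rV[R]_n) (i : 'I_n) :
  `|u 0 i| <= enorm u.
Proof. by rewrite -sqrtr_sqr ler_wsqrtr // sqr_coord_le. Qed.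

Lemma enorm_subC (R : realType) (n : nat) (u v : 'rV[R]_n) :
  enorm (u - v) = enorm (v - u).
Proof.
by congr Num.sqrt; apply: eq_bigr => i _; rewrite !mxE; ring.
Qed.

(** Turns the inner product of the prox-convexity inequality into squared distances. *)
Lemma polarization_sub (R : realType) (n : nat) (x y z : 'rV[R]_n) :
  2 * inner (x - z) (y - x) =
  enorm (z - y) ^+ 2 - enorm (x - z) ^+ 2 - enorm (x - y) ^+ 2.
Proof.
rewrite !sqr_enorm /inner -!sumrB mulr_sumr.
by apply: eq_bigr => i _; rewrite !mxE; ring.
Qed.

Lemma near_enorm_sub_lt (R : realType) (n : nat) (p : 'rV[R]_n) (e : R) :
  0 < e -> \forall y \near p, enorm (y - p) < e.
Proof.
(* Coordinates within [d] give a squared norm of at most [n * d ^+ 2], which is below [e ^+ 2] even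
   when [n = 0]. *)
move=> e0; pose d := e / n.+1%:R.
have d0 : 0 < d by rewrite divr_gt0.
apply/nbhs_ballP; exists d => //= y [_ /(_ 0)] yp.
rewrite -(ltr_pXn2r (ltn0Sn 1)) ?nnegrE ?enorm_ge0 ?(ltW e0) // sqr_enorm.
apply: (@le_lt_trans _ _ (\sum_(i < n) d ^+ 2)).
  apply: ler_sum => i _; rewrite -expr2 !mxE -[_ ^+ 2]real_normK ?num_real //.
  rewrite ler_pXn2r ?nnegrE ?(ltW d0) //.
  by have := yp i; rewrite -ball_normE /= distrC => /ltW.
rewrite sumr_const card_ord -mulr_natr /d expr_div_n.
have n1 : 0 < n.+1%:R :> R by [].
rewrite mulrAC ltr_pdivrMr ?exprn_gt0 // ltr_pM2l ?exprn_gt0 //.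
rewrite -natrX ltr_nat; apply: leq_trans (ltnSn n) _.
by rewrite -[leqLHS]expn1 leq_pexp2l.
Qed.

(** The bound puts the sequence in a product of segments, whose intersection with [K] is compact;
    [p] is a cluster point there. *)
Lemma bounded_closed_cluster (R : realType) (n : nat) (K : set 'rV[R]_n)
    (w : nat -> 'rV[R]_n) (y : 'rV[R]_n) (B : R) :
  closed K -> (forall m, K (w m)) -> (forall m, enorm (w m - y) <= B) ->
  exists2 p, K p & forall m (e : R), 0 < e ->
    exists2 k, (m <= k)%N & enorm (w k - p) < e.
Proof.
move=> clK wK wB.
have cptA : compact [set v : 'rV[R]_n |
    forall i, v ord0 i \in `[y 0 i - B, y 0 i + B]].
  exact: (@rV_compact R n (fun i => [set` `[y 0 i - B, y 0 i + B]])
    (fun i => @segment_compact _ _ _)).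
have cpt := compact_closedI cptA clK.
have [|p [[_ Kp] clp]] := cpt (w @ \oo) _.
  apply: (nearW (F := \oo)) => m; split=> // i; rewrite /= in_itv /=.
  have := le_trans (coord_le_enorm (w m - y) i) (wB m).
  by rewrite !mxE ler_distl.
exists p => // m e e0.
have [v [[k mk <-] vp]] : ([set w k | k in [set k | (m <= k)%N]] `&`
    [set v | enorm (v - p) < e]) !=set0.
  apply: clp; last exact: near_enorm_sub_lt.
  by exists m => // k mk; exists k.
by exists k.
Qed.

(** * Convergence of quasi-Fejer sequences *)

(** The condition on [F] is lower semicontinuity along [K], which makes a cluster point of a
    minimizing subsequence a minimizer. The index [m0] leaves room for initial terms outside [K]. *)
Lemma quasi_fejer_cvg (R : realType) (n : nat) (K : set 'rV[R]_n)
    (F : 'rV[R]_n -> R) (z : nat -> 'rV[R]_n) (b : nat -> R) (c C : R)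
    (m0 : nat) (xs : 'rV[R]_n) :
  closed K ->
  (forall p, K p -> forall e : R, 0 < e -> exists2 d : R, 0 < d &
     forall y, K y -> enorm (y - p) < d -> F p < F y + e) ->
  (forall k, 0 < b k) ->
  (\sum_(0 <= k <oo) (b k)%:E = +oo)%E ->
  (\sum_(0 <= k <oo) (b k ^+ 2)%:E < +oo)%E ->
  0 < c -> 0 <= C ->
  (forall k, (m0 <= k)%N -> K (z k)) ->
  (forall k, (m0 <= k)%N -> forall y, K y ->
     enorm (z k.+1 - y) ^+ 2 + c * b k * (F (z k) - F y) <=
     enorm (z k - y) ^+ 2 + C * b k ^+ 2) ->
  K xs -> (forall y, K y -> F xs <= F y) ->
  exists2 p, (K p /\ forall y, K y -> F p <= F y) &
    forall e : R, 0 < e -> exists m, forall k, (m <= k)%N ->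
      enorm (z k - p) < e.
Proof.
move=> clK Fcont b0 bsum b2sum c0 C0 zK fejer Kxs xsmin.
have b2_ge0 k : 0 <= b k ^+ 2 by exact: sqr_ge0.
have tail := nonneg_series_tail_lt b2_ge0 b2sum.
have fejer_sum y p M : K y -> (m0 <= p <= M)%N ->
    enorm (z M - y) ^+ 2 + \sum_(p <= k < M) c * b k * (F (z k) - F y) <=
    enorm (z p - y) ^+ 2 + C * \sum_(p <= k < M) b k ^+ 2.
  move=> Ky /andP[mp pM]; rewrite mulr_sumr.
  apply: (quasi_fejer_sum (a := fun k => enorm (z k - y) ^+ 2) (m := m0)) => //.
  by move=> k mk; exact: fejer.
have fejer_min y p M : K y -> (forall u, K u -> F y <= F u) ->
    (m0 <= p <= M)%N -> enorm (z M - y) ^+ 2 <=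
    enorm (z p - y) ^+ 2 + C * \sum_(p <= k < M) b k ^+ 2.
  move=> Ky ymin pM; apply: le_trans (fejer_sum y p M Ky pM).
  rewrite lerDl big_nat; apply: sumr_ge0 => k /andP[pk _].
  rewrite mulr_ge0 ?mulr_ge0 ?(ltW c0) ?(ltW (b0 k)) // subr_ge0 ymin //.
  apply: zK.
  by case/andP: pM => mp _; exact: leq_trans mp pk.
(* From [m1] on the squares sum to less than 1, so the accumulated error is at most [C]. *)
have [m1' tail1] := tail 1 ltr01.
pose m1 := maxn m0 m1'.
have m01 : (m0 <= m1)%N by exact: leq_maxl.
have tailC p M : (m1 <= p)%N -> C * \sum_(p <= k < M) b k ^+ 2 <= C.
  move=> mp; rewrite -[leRHS]mulr1 ler_wpM2l // ltW // tail1 //.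
  by apply: leq_trans mp; exact: leq_maxr.
have freq (e : R) m : 0 < e ->
    exists k, (maxn m m1 <= k)%N /\ F (z k) < F xs + e.
  move=> e0; apply: contrapT => nofreq.
  pose m2 := maxn m m1.
  have m12 : (m1 <= m2)%N by exact: leq_maxr.
  (* If the gap were at least [e] from [m2] on, a block of [b] above this threshold would make the
     summed decrease exceed the initial squared distance plus [C]. *)
  have [M m2M] := nonneg_series_pinfty_gt (fun k => ltW (b0 k)) bsum m2
    ((enorm (z m2 - xs) ^+ 2 + C) / (c * e)).
  rewrite ltr_pdivrMr ?mulr_gt0 // => big.
  have := fejer_sum xs m2 M Kxs; rewrite (leq_trans m01 m12) m2M => /(_ isT).
  have := tailC m2 M m12.
  have : (\sum_(m2 <= k < M) b k) * (c * e) <=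
      \sum_(m2 <= k < M) c * b k * (F (z k) - F xs).
    rewrite mulr_suml big_nat [leRHS]big_nat; apply: ler_sum => k /andP[m2k _].
    rewrite mulrCA mulrA ler_pM2l ?mulr_gt0 // lerBrDl leNgt.
    by apply/negP => lt_k; apply: nofreq; exists k.
  have := sqr_ge0 (enorm (z M - xs)); lra.
have /choice[kk kkP] : forall m, exists k,
    (maxn m m1 <= k)%N /\ F (z k) < F xs + m.+1%:R^-1.
  by move=> m; apply: freq; rewrite invr_gt0.
have kk_ge m : (m <= kk m)%N.
  by apply: leq_trans (proj1 (kkP m)); exact: leq_maxl.
have kk_ge1 m : (m1 <= kk m)%N.
  by apply: leq_trans (proj1 (kkP m)); exact: leq_maxr.
have wK m : K (z (kk m)) by apply: zK; exact: leq_trans (kk_ge1 m).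
(* The Fejer inequality bounds the squared distance; [t <= t ^+ 2 + 1] then bounds the distance
   itself. *)
have [|p Kp clp] := bounded_closed_cluster (w := z \o kk) (y := xs)
    (B := enorm (z m1 - xs) ^+ 2 + C + 1) clK wK.
  move=> m /=.
  have := fejer_min xs m1 (kk m) Kxs xsmin; rewrite m01 kk_ge1 => /(_ isT).
  have := tailC m1 (kk m) (leqnn _).
  have := sqr_ge0 (enorm (z (kk m) - xs) - 1).
  have := enorm_ge0 (z (kk m) - xs); nra.
have pmin y : K y -> F p <= F y.
  move=> Ky; apply: le_trans (xsmin y Ky).
  apply/ler_addgt0Pr => e e0; have e2 : 0 < e / 2 by exact: divr_gt0.
  have [d d0 Fd] := Fcont p Kp (e / 2) e2.
  have [m _ small] := near_infty_natSinv_lt (PosNum e2).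
  have [k mk /= /Fd] := clp m d d0.
  move=> /(_ (wK k)).
  have := (kkP k).2; have : k.+1%:R^-1 < e / 2 := small k mk.
  move: k.+1%:R^-1 => t; lra.
exists p => // e e0; have e2 : 0 < e / 2 by exact: divr_gt0.
(* The error is then at most [e ^+ 2 / 2]; adding [(e / 2) ^+ 2] from the cluster point stays below
   [e ^+ 2]. The [+ 1] covers [C = 0]. *)
have eC0 : 0 < e ^+ 2 / (2 * (C + 1)).
  by rewrite divr_gt0 ?exprn_gt0 // mulr_gt0 // ltr_wpDl.
have [m3 tail3] := tail _ eC0.
have [k m3k /= wp] := clp m3 (e / 2) e2.
exists (kk k) => M kM.
have := fejer_min p (kk k) M Kp pmin.
rewrite (leq_trans m01 (kk_ge1 k)) kM => /(_ isT).
have /ltW := tail3 (kk k) M (leq_trans m3k (kk_ge k)).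
rewrite ler_pdivlMr ?mulr_gt0 ?ltr_wpDl // => tl.
have S0 : 0 <= \sum_(kk k <= i < M) b i ^+ 2 by exact: sumr_ge0.
rewrite -(ltr_pXn2r (ltn0Sn 1)) ?nnegrE ?enorm_ge0 ?(ltW e0) //.
have : enorm (z (kk k) - p) ^+ 2 < (e / 2) ^+ 2.
  by rewrite ltr_pXn2r ?nnegrE ?enorm_ge0 // divr_ge0 ?(ltW e0).
have := exprn_gt0 2 e0.
rewrite expr_div_n -natrX; nra.
Qed.

(** * A single proximal step *)

(** Prox-convexity multiplied by [2 * (beta / alpha)], with the inner product expanded by
    polarization. *)
Lemma prox_step (R : realType) (n : nat) (K : set 'rV[R]_n) (beta alpha : R)
    (h : 'rV[R]_n -> \bar R) (g : 'rV[R]_n -> R) (z xb y : 'rV[R]_n) :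
  (forall u, K u -> h u = (g u)%:E) -> 0 < beta -> 0 < alpha ->
  prox_convex_with beta alpha K h -> K z -> Prox beta h K z xb -> K y ->
  enorm (xb - y) ^+ 2 + enorm (xb - z) ^+ 2 + 2 * (beta / alpha) * (g xb - g y)
    <= enorm (z - y) ^+ 2.
Proof.
move=> hg beta0 alpha0 pc Kz pxb Ky.
have Kxb := pxb.1.
have := (pc z Kz).2 xb pxb y Ky.
rewrite !hg // -EFinB lee_fin -[alpha / beta]invf_div ler_pdivlMl ?divr_gt0 //.
have := polarization_sub xb y z; lra.
Qed.

(** With [y = z] in [prox_step], the squared length is at most [beta / alpha] times the decrease of
    [g], hence at most [beta / alpha * L] times the length. A nonzero length cancels. *)
Lemma prox_step_length (R : realType) (n : nat) (K : set 'rV[R]_n)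
    (beta alpha L : R) (h : 'rV[R]_n -> \bar R) (g : 'rV[R]_n -> R)
    (z xb : 'rV[R]_n) :
  (forall u, K u -> h u = (g u)%:E) -> 0 < beta -> 0 < alpha -> 0 <= L ->
  (forall u v, K u -> K v -> `|g u - g v| <= L * enorm (u - v)) ->
  prox_convex_with beta alpha K h -> K z -> Prox beta h K z xb ->
  enorm (xb - z) <= beta / alpha * L.
Proof.
move=> hg beta0 alpha0 L0 lip pc Kz pxb.
have := prox_step hg beta0 alpha0 pc Kz pxb Kz.
rewrite [enorm (z - z) ^+ 2]sqr_enorm subrr.
have -> : inner (0 : 'rV[R]_n) 0 = 0.
  by apply: big1 => i _; rewrite !mxE mul0r.
have := lip z xb Kz pxb.1; rewrite enorm_subC ler_norml => /andP[_].
have : 0 < beta / alpha by exact: divr_gt0.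
have := enorm_ge0 (xb - z); rewrite le_eqVlt => /orP[/eqP<-|].
  by move=> *; rewrite mulr_ge0 // ltW.
move: (enorm _) (beta / alpha) => d t d0 t0 gd step.
rewrite -(ler_pM2l d0); nra.
Qed.

(** * One cycle of proximal steps, from [w 0] to [w N] *)

Section ProxCycle.

Variables (R : realType) (n : nat) (K : set 'rV[R]_n) (N : nat).
Variables (f : 'I_N -> 'rV[R]_n -> \bar R) (g : 'I_N -> 'rV[R]_n -> R).
Variables (beta alpha L : R) (s : {perm 'I_N}) (w : nat -> 'rV[R]_n).
Hypothesis fg : forall i u, K u -> f i u = (g i u)%:E.
Hypotheses (beta_gt0 : 0 < beta) (alpha_gt0 : 0 < alpha) (L_ge0 : 0 <= L).
Hypothesis g_lip : forall i u v, K u -> K v ->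
  `|g i u - g i v| <= L * enorm (u - v).
Hypothesis f_prox_convex : forall i, prox_convex_with beta alpha K (f i).
Hypothesis w0K : K (w 0).
Hypothesis w_prox : forall j : 'I_N, Prox beta (f (s j)) K (w j) (w j.+1).

Lemma prox_cycle_in (j : nat) : (j <= N)%N -> K (w j).
Proof. by case: j => // j jN; exact: (w_prox (Ordinal jN)).1. Qed.

Lemma prox_cycle_length (j : nat) : (j < N)%N ->
  enorm (w j.+1 - w j) <= beta / alpha * L.
Proof.
move=> jN; pose o := Ordinal jN.
exact: (prox_step_length (fg (s o)) beta_gt0 alpha_gt0 L_ge0 (g_lip (s o))
  (f_prox_convex (s o)) (prox_cycle_in (ltnW jN)) (w_prox o)).
Qed.

(** Stated per coordinate because the final convergence is tested in sup-norm balls. *)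
Lemma prox_cycle_coord (j : nat) (i : 'I_n) : (j <= N)%N ->
  `|w j 0 i - w 0 0 i| <= j%:R * (beta / alpha * L).
Proof.
elim: j => [_|j IH jN]; first by rewrite subrr normr0 mul0r.
have := coord_le_enorm (w j.+1 - w j) i; rewrite !mxE.
have := prox_cycle_length jN; have := IH (ltnW jN).
have := ler_distD (w j 0 i) (w j.+1 0 i) (w 0 0 i).
rewrite -(natr1 j); lra.
Qed.

(** Each step changes every component, not only the one being processed, by at most [L] times its
    length. *)
Lemma prox_cycle_value (j : nat) (i : 'I_N) : (j <= N)%N ->
  `|g i (w j) - g i (w 0)| <= j%:R * (L * (beta / alpha * L)).
Proof.
elim: j => [_|j IH jN]; first by rewrite subrr normr0 mul0r.
have := g_lip i (prox_cycle_in jN) (prox_cycle_in (ltnW jN)).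
have := ler_wpM2l L_ge0 (prox_cycle_length jN); have := IH (ltnW jN).
have := ler_distD (g i (w j)) (g i (w j.+1)) (g i (w 0)).
rewrite -(natr1 j); lra.
Qed.

(** Summing [prox_step] telescopes the distances. Moving each value from [w i.+1] back to [w 0]
    costs a term linear in [beta], which the factor [2 / alpha * beta] makes quadratic. *)
Lemma prox_cycle_fejer (y : 'rV[R]_n) : K y ->
  enorm (w N - y) ^+ 2 +
    2 / alpha * beta * (\sum_(i < N) g i (w 0) - \sum_(i < N) g i y)
  <= enorm (w 0 - y) ^+ 2 + 2 * (N%:R * (L / alpha)) ^+ 2 * beta ^+ 2.
Proof.
move=> Ky.
rewrite -lerBrDl; set c := _ * beta.
have sumperm u : \sum_(i < N) g i u = \sum_(i < N) g (s i) u.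
  by rewrite (reindex_inj (@perm_inj _ s)).
rewrite !sumperm -sumrB mulr_sumr.
suff : \sum_(i < N) (enorm (w i.+1 - y) ^+ 2 - enorm (w i - y) ^+ 2) +
    \sum_(i < N) c * (g (s i) (w 0) - g (s i) y) <=
    \sum_(i < N) c * (N%:R * (L * (beta / alpha * L))).
  rewrite -(big_mkord xpredT
    (fun i => enorm (w i.+1 - y) ^+ 2 - enorm (w i - y) ^+ 2)).
  rewrite telescope_sumr // sumr_const card_ord -[_ *+ N]mulr_natr.
  have -> : c * (N%:R * (L * (beta / alpha * L))) * N%:R =
     2 * (N%:R * (L / alpha)) ^+ 2 * beta ^+ 2.
    by rewrite /c; field; rewrite gt_eqF.
  lra.
rewrite -big_split; apply: ler_sum => i _ /=.
have c0 : 0 < c by rewrite /c !mulr_gt0 // invr_gt0.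
have Kwi := prox_cycle_in (ltnW (ltn_ord i)).
have := prox_step (fg (s i)) beta_gt0 alpha_gt0 (f_prox_convex (s i)) Kwi
  (w_prox i) Ky.
have -> : 2 * (beta / alpha) = c by rewrite /c; field; rewrite gt_eqF.
have := sqr_ge0 (enorm (w i.+1 - w i)).
have h0 : 0 <= L * (beta / alpha * L).
  by rewrite mulr_ge0 // mulr_ge0 // ltW // divr_gt0.
have : `|g (s i) (w i.+1) - g (s i) (w 0)| <= N%:R * (L * (beta / alpha * L)).
  apply: le_trans (prox_cycle_value (s i) (ltn_ord i)) _.
  by rewrite ler_wpM2r // ler_nat.
rewrite ler_norml => /andP[/(ler_wpM2l (ltW c0)) + _].
lra.
Qed.

End ProxCycle.

(** * From cycle endpoints to the whole sequence *)

Theorem theorem3p1 (R : realType) (n : nat) (K : set 'rV[R]_n)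
  (K_nonempty : K !=set0) (K_closed : closed K)
  (N : nat) (N_gt0 : (0 < N)%N)
  (f : 'I_N -> 'rV[R]_n -> \bar R)
  (f_proper : forall i, proper_on K (f i))
  (f_lsc : forall i, lsc_on K (f i))
  (beta : nat -> R)
  (beta_gt0 : forall k, 0 < beta k)
  (beta_sum : (\sum_(0 <= k <oo) (beta k)%:E = +oo)%E)
  (beta_sum2 : (\sum_(0 <= k <oo) (beta k ^+ 2)%:E < +oo)%E)
  (pi_ : nat -> {perm 'I_N})
  (x : nat -> 'rV[R]_n)
  (x_rec : forall (k : nat) (j : 'I_N),
     Prox (beta k) (f (pi_ k j)) K (x (k * N + j)%N) (x (k * N + j.+1)%N))
  (argmin_nonempty : argmin_on K (fun y => \sum_(i < N) f i y)%E !=set0)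
  (L : R) (f_lipschitz : forall i, elipschitz_on K L (f i))
  (alpha : R) (alpha_gt0 : 0 < alpha)
  (f_prox_convex : forall (i : 'I_N) (k : nat),
     prox_convex_with (beta k) alpha K (f i)) :
  exists2 xstar : 'rV[R]_n,
    argmin_on K (fun y => \sum_(i < N) f i y)%E xstar & x @ \oo --> xstar.
Proof.
have [xs [Kxs xsmin]] := argmin_nonempty.
pose g i u := fine (f i u).
have fg i u : K u -> f i u = (g i u)%:E.
  move=> Ku; rewrite /g fineK // fin_numE; apply/andP.
  by split; apply/eqP => fu; have := f_lipschitz i u u Ku Ku; rewrite fu.
(* The sign of [L] is not prescribed, so its absolute value serves as the nonnegative constant. *)
have g_lip i u v : K u -> K v -> `|g i u - g i v| <= `|L| * enorm (u - v).
  move=> Ku Kv; have := f_lipschitz i u v Ku Kv.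
  rewrite !fg // -EFinB abse_EFin lee_fin => /le_trans; apply.
  by rewrite ler_wpM2r ?enorm_ge0 // ler_norm.
pose F u := \sum_(i < N) g i u.
have fF u : K u -> (\sum_(i < N) f i u = (F u)%:E)%E.
  by move=> Ku; rewrite -sumEFin; apply: eq_bigr => i _; exact: fg.
have F_min y : K y -> F xs <= F y.
  by move=> Ky; have := xsmin y Ky; rewrite !fF.
have F_cont p : K p -> forall e : R, 0 < e -> exists2 d : R, 0 < d &
    forall y, K y -> enorm (y - p) < d -> F p < F y + e.
  move=> Kp e e0.
  have M0 : 0 < N%:R * `|L| + 1 by rewrite ltr_wpDl // mulr_ge0.
  exists (e / (N%:R * `|L| + 1)); first exact: divr_gt0.
  move=> y Ky; rewrite ltr_pdivlMr // => yp.
  have : F p - F y <= N%:R * `|L| * enorm (y - p).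
    rewrite -sumrB -mulrA mulr_natl -[N in leRHS]card_ord -sumr_const.
    apply: ler_sum => i _; apply: le_trans (ler_norm _) _.
    by rewrite enorm_subC; exact: g_lip.
  have := enorm_ge0 (y - p); lra.
(* The initial point need not lie in [K], so the first cycle is discarded. *)
have zK k : (1 <= k)%N -> K (x (k * N + 0)%N).
  case: k => // k _; have lastN : (N.-1 < N)%N by rewrite prednK.
  have := (x_rec k (Ordinal lastN)).1.
  by rewrite /= prednK // addn0 mulSn addnC.
have fejer k : (1 <= k)%N -> forall y, K y ->
     enorm (x (k.+1 * N + 0)%N - y) ^+ 2 +
       2 / alpha * beta k * (F (x (k * N + 0)%N) - F y) <=
     enorm (x (k * N + 0)%N - y) ^+ 2 +
       2 * (N%:R * (`|L| / alpha)) ^+ 2 * beta k ^+ 2.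
  move=> k1 y Ky; rewrite [(k.+1 * N + 0)%N]addn0 mulSn [(N + _)%N]addnC.
  exact: (prox_cycle_fejer (w := fun j => x (k * N + j)%N) fg (beta_gt0 k)
    alpha_gt0 (normr_ge0 L) g_lip (f_prox_convex^~ k) (zK k k1) (x_rec k) Ky).
have [||p [Kp pmin] zp] := quasi_fejer_cvg K_closed F_cont beta_gt0 beta_sum
  beta_sum2 _ _ zK fejer Kxs F_min.
- by rewrite divr_gt0.
- by rewrite mulr_ge0 // sqr_ge0.
exists p; first by split=> // y Ky; rewrite !fF // lee_fin pmin.
apply/cvg_ballP => e e0.
have e2 : 0 < e / 2 by exact: divr_gt0.
have [m1 zm1] := zp _ e2.
(* Within cycle [k] each coordinate drifts by at most [beta k * H]; the [+ 1] keeps [H] positive. *)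
pose H := N%:R * (alpha^-1 * `|L|) + 1.
have H0 : 0 < H by rewrite ltr_wpDl // !mulr_ge0 // ltW // invr_gt0.
(* Applied to blocks of length one, this gives [beta k < e / 2 / H] eventually. *)
have [m2 beta_small] := nonneg_series_tail_lt (fun k => sqr_ge0 (beta k))
  beta_sum2 (exprn_gt0 2 (divr_gt0 e2 H0)).
(* The factor [N] turns a bound on [l] into one on its cycle [l %/ N]; the 1 skips the discarded
   cycle. *)
exists (maxn 1 (maxn m1 m2) * N)%N => // l /=; rewrite -leq_divRL //.
rewrite !geq_max => /and3P[k1 k_m1 k_m2].
rewrite [l](divn_eq l N); split=> // i0 i; rewrite ord1 -ball_normE /= distrC.
set k := (l %/ N)%N in k1 k_m1 k_m2 *.
have := prox_cycle_coord (w := fun j => x (k * N + j)%N) fg (beta_gt0 k)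
  alpha_gt0 (normr_ge0 L) g_lip (f_prox_convex^~ k) (zK k k1) (x_rec k) i
  (ltnW (ltn_pmod l N_gt0)).
have : beta k < e / 2 / H.
  rewrite -(ltr_pXn2r (ltn0Sn 1)) ?nnegrE ?(ltW (beta_gt0 k)) //; last first.
    by rewrite ltW // divr_gt0.
  by have := beta_small k k.+1 k_m2; rewrite big_nat1.
rewrite ltr_pdivlMr //.
have := coord_le_enorm (x (k * N + 0)%N - p) i; rewrite !mxE.
have := zm1 k k_m1.
have := ler_distD (x (k * N + 0)%N 0 i) (x (k * N + l %% N)%N 0 i) (p 0 i).
have : (l %% N)%:R * (beta k / alpha * `|L|) <= beta k * H.
  apply: (@le_trans _ _ (N%:R * (beta k / alpha * `|L|))).
    rewrite ler_wpM2r ?ler_nat ?(ltnW (ltn_pmod l N_gt0)) //.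
    by rewrite mulr_ge0 // ltW // divr_gt0.
  by have := beta_gt0 k; rewrite /H; lra.
lra.
Qed.
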